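(* Let $(\alpha_0,\alpha_1,\alpha_2,\alpha_3)$ be a rotation quadrangle (in the generic sense described in the context), with relative revolute axes $r_{01}, r_{12}, r_{23}, r_{30}$ in the moving space, and let $u$ and $v$ be the two transversals of these four axes. Then the locus of points $X$ in the moving space whose homologous images $\alpha_0(X),\alpha_1(X),\alpha_2(X),\alpha_3(X)$ lie on a circle consists of the four relative revolute axes $r_{01}$, $r_{12}$, $r_{23}$, $r_{30}$ and their two transversals $u$ and $v$.
   Context: A displacement is a proper (orientation-preserving) Euclidean motion of three-space, viewed as a map $\alpha$ from a moving space to a fixed space, both copies of Euclidean three-space. Indices are taken modulo four. For four displacements $\alpha_0,\alpha_1,\alpha_2,\alpha_3$ the relative displacements of consecutive positions are $\tau_{i,i+1}=\alpha_{i+1}\circ\alpha_i^{-1}$. The quadruple $(\alpha_0,\alpha_1,\alpha_2,\alpha_3)$ is called a rotation quadrangle (or rotation quadrilateral) if each of $\tau_{01},\tau_{12},\tau_{23},\tau_{30}$ is a pure rotation (about some line). The relative revolute axis $r_{i,i+1}$ in the moving space is the line of points $X$ with $\alpha_i(X)=\alpha_{i+1}(X)$; equivalently, $\alpha_i(r_{i,i+1})=\alpha_{i+1}(r_{i,i+1})$ is the axis of $\tau_{i,i+1}$. The homologous images of a point $X$ of the moving space are $X_i=\alpha_i(X)$, $i=0,1,2,3$. Straight lines are regarded as special circles (of infinite radius). Standing genericity assumptions: Study's kinematic mapping represents a displacement by a unit dual quaternion $x+\epsilon y$ up to nonzero real scalar factor, i.e. by a point $[x_0:\dots:x_3:y_0:\dots:y_3]$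 of the Study quadric $\mathcal{S}=\{x_0y_0+x_1y_1+x_2y_2+x_3y_3=0\}$ in real projective space $P^7$ (with $x\neq 0$). Let $A_i\in\mathcal{S}$ be the image of $\alpha_i$. It is assumed throughout that the quadrilateral $A_0A_1A_2A_3$ spans a three-dimensional projective subspace that is not completely contained in $\mathcal{S}$. A transversal of the four axes is a line meeting all four of them; the configuration is taken to be generic, so that the four axes have precisely two transversals, denoted $u$ and $v$. *)

(* Defs.v *)
From HB Require Import structures.
From mathcomp Require Import all_boot all_order all_algebra.
From mathcomp Require Import boolp classical_sets reals.

Set Implicit Arguments.
Unset Strict Implicit.
Unset Printing Implicit Defensive.

Import Order.TTheory GRing.Theory Num.Theory.

Local Open Scope classical_set_scope.
Local Open Scope ring_scope.

Definition dot (R : realType) (n : nat) (x y : 'rV[R]_n) : R :=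
  \sum_(i < n) x 0 i * y 0 i.

(* Proper motions of Euclidean three-space, acting on row vectors. *)
Record displacement (R : realType) := Displacement {
  dlin : 'M[R]_3;
  dtrans : 'rV[R]_3;
  dlin_orth : dlin *m dlin^T = 1%:M;
  dlin_det : \det dlin = 1 }.

Definition dapp (R : realType) (a : displacement R) (X : 'rV[R]_3) : 'rV[R]_3 :=
  X *m dlin a + dtrans a.
Coercion dapp : displacement >-> Funclass.

Lemma dcomp_orth (R : realType) (b a : displacement R) :
  (dlin a *m dlin b) *m (dlin a *m dlin b)^T = 1%:M.
Proof.
by rewrite trmx_mul mulmxA -(mulmxA (dlin a)) dlin_orth mulmx1 dlin_orth.
Qed.

Lemma dcomp_det (R : realType) (b a : displacement R) :
  \det (dlin a *m dlin b) = 1.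
Proof. by rewrite det_mulmx !dlin_det mulr1. Qed.

Definition dcomp (R : realType) (b a : displacement R) : displacement R :=
  @Displacement R (dlin a *m dlin b) (dtrans a *m dlin b + dtrans b)
    (dcomp_orth b a) (dcomp_det b a).

Lemma dinv_orth (R : realType) (a : displacement R) :
  (dlin a)^T *m ((dlin a)^T)^T = 1%:M.
Proof. by rewrite trmxK; apply: mulmx1C; exact: dlin_orth. Qed.

Lemma dinv_det (R : realType) (a : displacement R) : \det (dlin a)^T = 1.
Proof. by rewrite det_tr dlin_det. Qed.

Definition dinv (R : realType) (a : displacement R) : displacement R :=
  @Displacement R (dlin a)^T (- (dtrans a *m (dlin a)^T))
    (dinv_orth a) (dinv_det a).

Lemma dcompE (R : realType) (b a : displacement R) (X : 'rV[R]_3) :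
  dcomp b a X = b (a X).
Proof. by rewrite /dapp /= mulmxDl mulmxA addrA. Qed.

Lemma dinvK (R : realType) (a : displacement R) (X : 'rV[R]_3) :
  dinv a (a X) = X.
Proof. by rewrite /dapp /= mulmxDl -mulmxA dlin_orth mulmx1 addrK. Qed.

Lemma dinvKV (R : realType) (a : displacement R) (X : 'rV[R]_3) :
  a (dinv a X) = X.
Proof.
rewrite /dapp /= mulmxDl mulNmx -!mulmxA.
by rewrite (mulmx1C (dlin_orth a)) !mulmx1 subrK.
Qed.

Definition is_line (R : realType) (l : set 'rV[R]_3) : Prop :=
  exists p d : 'rV[R]_3, d != 0 /\ l = [set X | exists t : R, X = p + t *: d].

Definition is_circle (R : realType) (C : set 'rV[R]_3) : Prop :=
  exists (c n : 'rV[R]_3) (rho : R), [/\ n != 0, 0 < rho &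
    C = [set X | dot (X - c) n = 0 /\ dot (X - c) (X - c) = rho ^+ 2]].

(* Straight lines count as circles of infinite radius. *)
Definition is_circle_or_line (R : realType) (C : set 'rV[R]_3) : Prop :=
  is_circle C \/ is_line C.

Definition is_rotation_about (R : realType) (l : set 'rV[R]_3)
    (t : displacement R) : Prop :=
  [/\ is_line l, forall X, l X -> t X = X & exists X, t X != X].

Definition pure_rotation (R : realType) (t : displacement R) : Prop :=
  exists l : set 'rV[R]_3, is_rotation_about l t.

(* Positions are indexed by the integers modulo four: [i + 1] in ['I_4] is
   cyclic. *)
Definition relative_displacement (R : realType)
    (alpha : 'I_4 -> displacement R) (i : 'I_4) : displacement R :=
  dcomp (alpha (i + 1)) (dinv (alpha i)).

Definition rotation_quadrangle (R : realType)
    (alpha : 'I_4 -> displacement R) : Prop :=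
  forall i : 'I_4, pure_rotation (relative_displacement alpha i).

(* The axis r_{i,i+1}, in the moving space. *)
Definition revolute_axis (R : realType)
    (alpha : 'I_4 -> displacement R) (i : 'I_4) : set 'rV[R]_3 :=
  [set X | alpha i X = alpha (i + 1) X].

Definition axes_transversal (R : realType)
    (alpha : 'I_4 -> displacement R) (l : set 'rV[R]_3) : Prop :=
  is_line l /\ forall i : 'I_4, l `&` revolute_axis alpha i !=set0.

Definition circle_locus (R : realType)
    (alpha : 'I_4 -> displacement R) : set 'rV[R]_3 :=
  [set X | exists C : set 'rV[R]_3,
     is_circle_or_line C /\ forall i : 'I_4, C (alpha i X)].

(* Quaternions x0 + x1 i + x2 j + x3 k, as rows (x0, x1, x2, x3). *)
Definition qmul (R : realType) (a b : 'rV[R]_4) : 'rV[R]_4 :=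
  \row_(k < 4) [:: a 0 0 * b 0 0 - a 0 1 * b 0 1 - a 0 2 * b 0 2 - a 0 3 * b 0 3;
                   a 0 0 * b 0 1 + a 0 1 * b 0 0 + a 0 2 * b 0 3 - a 0 3 * b 0 2;
                   a 0 0 * b 0 2 - a 0 1 * b 0 3 + a 0 2 * b 0 0 + a 0 3 * b 0 1;
                   a 0 0 * b 0 3 + a 0 1 * b 0 2 - a 0 2 * b 0 1 + a 0 3 * b 0 0
                ]`_k.

Definition qconj (R : realType) (a : 'rV[R]_4) : 'rV[R]_4 :=
  \row_(k < 4) (if k == 0 then a 0 k else - a 0 k).

Definition qvec (R : realType) (X : 'rV[R]_3) : 'rV[R]_4 :=
  row_mx (0 : 'rV[R]_1) X.

(* Homogeneous coordinates [x0 : ... : x3 : y0 : ... : y3] of the dual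
   quaternion x + eps y, with x = lsubmx A and y = rsubmx A. *)
Definition study_form (R : realType) (A : 'rV[R]_(4 + 4)) : R :=
  dot (lsubmx A) (rsubmx A).

Definition study_quadric (R : realType) : set 'rV[R]_(4 + 4) :=
  [set A | study_form A = 0].

(* For A on the Study quadric with x != 0, the dual quaternion acts on points by
     (x + eps y) (1 + eps X) (conj x - eps conj y)
       = |x|^2 + eps (x X conj x + y conj x - x conj y)
       = |x|^2 (1 + eps a(X)).
   This determines A from a up to a nonzero real factor. *)
Definition study_image (R : realType) (a : displacement R)
    (A : 'rV[R]_(4 + 4)) : Prop :=
  let x := lsubmx A in let y := rsubmx A in
  [/\ x != 0, study_quadric A &
    forall X : 'rV[R]_3,
      dot x x *: qvec (a X) =
        qmul (qmul x (qvec X)) (qconj x) + qmul y (qconj x) - qmul x (qconj y)].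

(* Main.v *)
Require Import Defs.
From HB Require Import structures.
From mathcomp Require Import all_boot all_order all_algebra.
From mathcomp Require Import boolp classical_sets reals.
From mathcomp Require Import ring lra.

Set Implicit Arguments.
Unset Strict Implicit.
Unset Printing Implicit Defensive.

Import Order.TTheory GRing.Theory Num.Theory.

Local Open Scope classical_set_scope.
Local Open Scope ring_scope.

(** Write X_i for alpha_i(X).

    Suppose that the X_i lie on a circle or a line and that X is on no axis, so
    that X_i and X_{i+1} differ.  Let sigma_i be the reflection in the
    perpendicular bisector of X_i and X_{i+1}.  This plane contains the axis of
    tau_{i,i+1}, because every point of that axis is equidistant from X_i and
    its rotated copy X_{i+1}.  Hence alpha_{i+1}^-1 sigma_i alpha_i is an
    orientation-reversing isometry that fixes X and every point of r_{i,i+1}: it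
    is the reflection rho_i in the plane spanned by X and r_{i,i+1}
    ([bisector_pullback]).  The four bisectors all contain the axis of the
    circle, and sigma_3 sigma_2 sigma_1 sigma_0 fixes this axis and X_0, so it is
    the identity; on a line the bisectors are parallel and the composition is a
    translation that fixes X_0 ([refl_chords]).  Therefore rho_3 rho_2 rho_1 rho_0
    is the identity too, and this forces the four planes to share a line g
    through X ([common_perp]).  In each plane, g meets the axis or is parallel to it.  If g
    meets all four axes it is a transversal, hence u or v.

    It remains to exclude that g is parallel to an axis ([axis_not_parallel]).
    In the projective sense g would be a third transversal.  Four lines with
    three pairwise skew transversals belong to a regulus, and all lines of the
    opposite regulus are transversals; if two of the transversals are coplanar
    they span a pencil of transversals instead.  Either way some ordinary line
    different from u and v meets all four axes, and explicit equations for such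
    a line cover all positions of g at once.

    Conversely, let X be on a transversal l that meets r_{i,i+1} in S_i.  The
    lines alpha_i(l), alpha_{i+1}(l) meet in the common image of S_i, at the
    same signed distance t_i from X_i and from X_{i+1}.  So the X_i are the points
    of contact of a skew quadrilateral with equal tangent segments at each
    vertex, and such points are concyclic unless all t_i agree
    ([tangential_concyclic]).  If they agree, the axes are concurrent and have
    more than two transversals ([not_concurrent]).  Finally a point of an axis
    has at most three distinct images, which always lie on a circle or a line. *)

(** * Vectors and reflections in three-space *)

Section Coordinates.
Variable R : realType.
Implicit Types x y : 'rV[R]_3.

Lemma ord3P (P : 'I_3 -> Prop) : P 0 -> P 1 -> P 2 -> forall i, P i.
Proof.
move=> P0 P1 P2 [[|[|[|//]]] hi].
- by rewrite (_ : Ordinal hi = 0) //; apply: val_inj.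
- by rewrite (_ : Ordinal hi = 1) //; apply: val_inj.
- by rewrite (_ : Ordinal hi = 2) //; apply: val_inj.
Qed.

Lemma row3P x y : x 0 0 = y 0 0 -> x 0 1 = y 0 1 -> x 0 2 = y 0 2 -> x = y.
Proof. by move=> *; apply/rowP; apply: ord3P. Qed.

Lemma sum3E (F : 'I_3 -> R) : \sum_i F i = F 0 + F 1 + F 2.
Proof.
rewrite !big_ord_recl big_ord0 addr0 addrA.
by congr (_ + F _ + F _); apply: val_inj.
Qed.

Lemma dotE x y : dot x y = x 0 0 * y 0 0 + x 0 1 * y 0 1 + x 0 2 * y 0 2.
Proof. exact: sum3E. Qed.

End Coordinates.

Ltac vec := apply: row3P; rewrite ?mxE ?dotE ?mxE /=.

Section Vectors.
Variable R : realType.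
Implicit Types (x y z m n p q d e : 'rV[R]_3) (a : displacement R).

Definition cross x y : 'rV[R]_3 :=
  \row_k [:: x 0 1 * y 0 2 - x 0 2 * y 0 1;
             x 0 2 * y 0 0 - x 0 0 * y 0 2;
             x 0 0 * y 0 1 - x 0 1 * y 0 0]`_k.

Lemma det3_rows x y z :
  \det (\matrix_(i < 3) [:: x; y; z]`_i) = dot (cross x y) z.
Proof.
rewrite (expand_det_row _ 2) sum3E /cofactor !(expand_det_row _ 0).
rewrite !big_ord_recl !big_ord0 /cofactor !det_mx11 !mxE /= dotE !mxE /=.
pose c (w : 'rV[R]_3) k := [:: w 0 0; w 0 1; w 0 2]`_k.
have cE (w : 'rV[R]_3) (i : 'I_3) : w 0 i = c w i by move: i; apply: ord3P.
rewrite !cE /c /=.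
ring.
Qed.

Lemma dot_mulmx x y : dot x y = (x *m y^T) 0 0.
Proof. by rewrite mxE; apply: eq_bigr => i _; rewrite mxE. Qed.

Lemma dot_rot a x y : dot (x *m dlin a) (y *m dlin a) = dot x y.
Proof.
by rewrite !dot_mulmx trmx_mul mulmxA -(mulmxA x) dlin_orth mulmx1.
Qed.

(** Cramer's rule: the coordinates of [m] in the basis [x], [y], [z], without
    division. *)
Lemma cramer3 x y z m :
  dot (cross x y) z *: m =
    dot m (cross y z) *: x + dot m (cross z x) *: y + dot m (cross x y) *: z.
Proof. vec; ring. Qed.

(** Orientation enters the whole argument only through this lemma and
    [cross_refl]: rotations preserve the cross product, reflections negate it. *)
Lemma cross_rot a x y : cross (x *m dlin a) (y *m dlin a) = cross x y *m dlin a.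
Proof.
have rowsM z : \matrix_(i < 3) [:: x; y; z]`_i *m dlin a =
    \matrix_(i < 3) [:: x *m dlin a; y *m dlin a; z *m dlin a]`_i.
  by apply/row_matrixP; apply: ord3P; rewrite row_mul !rowK.
have dotP (b c : 'rV[R]_3) : (forall z, dot b z = dot c z) -> b = c.
  move=> h; have e i : b 0 i = c 0 i.
    have := h (delta_mx 0 i); rewrite /dot (bigD1 i) //= [in RHS](bigD1 i) //=.
    rewrite !mxE !eqxx !mulr1 !big1 ?addr0 // => j ji;
    by rewrite mxE (negbTE ji) andbF mulr0.
  exact/rowP.
apply: dotP => z.
rewrite -[z]mulmx1 -(mulmx1C (dlin_orth a)) mulmxA.
by rewrite -det3_rows -rowsM det_mulmx dlin_det mulr1 det3_rows dot_rot.
Qed.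

Lemma dot_gt0 x : x != 0 -> 0 < dot x x.
Proof.
move=> x0; have h : 0 <= dot x x by apply: sumr_ge0 => i _; rewrite -expr2 sqr_ge0.
rewrite lt_def h andbT; apply: contraNneq x0.
move/eqP; rewrite psumr_eq0 => [/allP z|i _]; last by rewrite -expr2 sqr_ge0.
apply/eqP/rowP => i; rewrite mxE; apply/eqP.
by have := z i (mem_index_enum i); rewrite mulf_eq0 orbb.
Qed.

Lemma dot_neq0 x : x != 0 -> dot x x != 0.
Proof. by move/dot_gt0; rewrite lt_def => /andP[]. Qed.

Lemma dotC x y : dot x y = dot y x.
Proof. by rewrite !dotE; ring. Qed.

Lemma dotDl x y z : dot (x + y) z = dot x z + dot y z.
Proof. by rewrite !dotE !mxE; ring. Qed.

Lemma dotZl (k : R) x y : dot (k *: x) y = k * dot x y.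
Proof. by rewrite !dotE !mxE; ring. Qed.

Lemma dotNl x y : dot (- x) y = - dot x y.
Proof. by rewrite !dotE !mxE; ring. Qed.

Lemma dotDr x y z : dot x (y + z) = dot x y + dot x z.
Proof. by rewrite !dotE !mxE; ring. Qed.

Lemma dotZr (k : R) x y : dot x (k *: y) = k * dot x y.
Proof. by rewrite !dotE !mxE; ring. Qed.

Lemma dotNr x y : dot x (- y) = - dot x y.
Proof. by rewrite !dotE !mxE; ring. Qed.

Lemma dot_crossl x y : dot (cross x y) x = 0.
Proof. by rewrite !dotE !mxE /=; ring. Qed.

Lemma dot_crossr x y : dot (cross x y) y = 0.
Proof. by rewrite !dotE !mxE /=; ring. Qed.

Lemma cross_eq0 x y : x != 0 -> cross x y = 0 -> y = (dot x y / dot x x) *: x.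
Proof.
move=> x0 c0; have xx := dot_neq0 x0.
have := congr1 (fun w => cross w x) c0.
have -> : cross (cross x y) x = dot x x *: y - dot x y *: x by vec; ring.
have -> : cross 0 x = 0 by vec; ring.
move/eqP; rewrite subr_eq0 => /eqP e.
by rewrite mulrC -scalerA -e scalerA mulVf // scale1r.
Qed.

Lemma cross_neq0 x y : cross x y != 0 -> (x != 0) && (y != 0).
Proof.
apply: contraNT; rewrite negb_and !negbK => /orP[]/eqP->; apply/eqP; vec; ring.
Qed.

Lemma perp_exists x : exists2 g, g != 0 & dot g x = 0.
Proof.
have [-> | x0] := eqVneq x 0.
  exists (delta_mx 0 0).
    by apply/eqP => /rowP/(_ 0)/eqP; rewrite !mxE /= oner_eq0.
  by rewrite !dotE !mxE; ring.
have [/eqP c0 | ] := boolP (cross x (delta_mx 0 0) == 0).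
  exists (delta_mx 0 1).
    by apply/eqP => /rowP/(_ 1)/eqP; rewrite !mxE /= oner_eq0.
  have := congr1 (fun w : 'rV[R]_3 => w 0 2) c0.
  rewrite !mxE /= !dotE !mxE /= => h; lra.
by exists (cross x (delta_mx 0 0)) => //; exact: dot_crossl.
Qed.

(** Two independent vectors and their cross product form a basis. *)
Lemma linear_eq3 (f g : {linear 'rV[R]_3 -> 'rV[R]_3}) x y :
  cross x y != 0 -> f x = g x -> f y = g y -> f (cross x y) = g (cross x y) ->
  forall z, f z = g z.
Proof.
move=> xy fx fy fxy z.
have := congr1 f (cramer3 x y (cross x y) z).
have := congr1 g (cramer3 x y (cross x y) z).
rewrite !linearD !linearZ /= fx fy fxy => <- /eqP.
rewrite -subr_eq0 -scalerBr scaler_eq0 (negbTE (dot_neq0 xy)) /=.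
by rewrite subr_eq0 => /eqP.
Qed.

(** The reflection in the plane through the origin with normal vector [m]. *)
Definition refl m x := x - (2 * dot x m / dot m m) *: m.

Fact refl_is_linear m : linear (refl m).
Proof. by move=> k x y; rewrite /refl; vec; ring. Qed.

HB.instance Definition _ m :=
  GRing.isLinear.Build R 'rV[R]_3 'rV[R]_3 _ (refl m) (refl_is_linear m).

Lemma refl_fix m x : dot x m = 0 -> refl m x = x.
Proof. by rewrite /refl => ->; rewrite mulr0 mul0r scale0r subr0. Qed.

Lemma refl_normal m : m != 0 -> refl m m = - m.
Proof.
move/dot_neq0 => mm; rewrite /refl -mulrA divff // mulr1.
by vec; ring.
Qed.

Lemma reflZ (k : R) m : k != 0 -> refl (k *: m) =1 refl m.
Proof.
move=> k0 x; rewrite /refl scalerA !(dotZl, dotZr); congr (_ - _ *: _).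
have [->|m0] := eqVneq m 0; first by rewrite !dotE !mxE; ring.
by have := dot_neq0 m0 => mm; field; rewrite ?k0 ?mm.
Qed.

Lemma reflK m : m != 0 -> cancel (refl m) (refl m).
Proof.
move=> m0 x; rewrite [X in refl m X]/refl linearB linearZ /= refl_normal //.
by rewrite /refl scalerN opprK subrK.
Qed.

Lemma refl_swap x y : dot x x = dot y y -> x != y -> refl (y - x) x = y.
Proof.
move=> xy; rewrite eq_sym -subr_eq0 => m0; have := dot_neq0 m0; rewrite /refl.
have -> : dot (y - x) (y - x) = - 2 * dot x (y - x).
  rewrite !(dotDl, dotDr, dotNl, dotNr) -xy (dotC y x); ring.
rewrite mulf_eq0 => /norP[_ n0].
rewrite (_ : 2 * _ / _ = -1); first by rewrite scaleN1r opprK addrC subrK.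
by field.
Qed.

Lemma cross_refl m x y : m != 0 ->
  cross (refl m x) (refl m y) = - refl m (cross x y).
Proof.
move/dot_neq0 => m0; rewrite /refl; set k := 2 / dot m m.
have -> : 2 * dot x m / dot m m = k * dot x m by rewrite mulrAC.
have -> : 2 * dot y m / dot m m = k * dot y m by rewrite mulrAC.
have -> : 2 * dot (cross x y) m / dot m m = k * dot (cross x y) m by rewrite mulrAC.
have hk : k * dot m m = 2 by rewrite mulfVK.
have -> : cross (x - (k * dot x m) *: m) (y - (k * dot y m) *: m)
   = cross x y - k *: (dot m m *: cross x y - dot (cross x y) m *: m).
  vec; ring.
rewrite scalerBr scalerA hk; vec; ring.
Qed.

Lemma refl_parallel m n : m != 0 -> n != 0 -> cross m n = 0 -> refl n =1 refl m.
Proof.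
move=> m0 n0 c0; rewrite (cross_eq0 m0 c0); apply: reflZ.
apply: contraNneq n0 => h; rewrite (cross_eq0 m0 c0) h scale0r //.
Qed.

Lemma refl_inj m n : m != 0 -> n != 0 -> refl m =1 refl n -> cross m n = 0.
Proof.
move=> m0 n0 /(_ m); rewrite refl_normal // /refl => h.
have -> : m = (dot m n / dot n n) *: n.
  have -> : (dot m n / dot n n) *: n = 2^-1 *: ((2 * dot m n / dot n n) *: n).
    by rewrite scalerA; congr (_ *: _); have := dot_neq0 n0 => nn; field.
  have -> : (2 * dot m n / dot n n) *: n = m + m.
    by rewrite -[X in _ = X + m]opprK h opprB subrK.
  by rewrite -mulr2n -scaler_nat scalerA mulVf ?scale1r ?pnatr_eq0.
by move: (_ / _) => k; vec; ring.
Qed.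

(** Four planes through a point whose reflections compose to the identity have a
    common line.  Indeed the first two reflections compose to the same rotation
    as the last two.  If this rotation is not the identity, its axis is the
    intersection of the first two planes and also that of the last two;
    otherwise the planes coincide in pairs. *)
Lemma common_perp n0 n1 n2 n3 :
  n0 != 0 -> n1 != 0 -> n2 != 0 -> n3 != 0 ->
  (forall z, refl n3 (refl n2 (refl n1 (refl n0 z))) = z) ->
  exists2 g, g != 0 & [/\ dot g n0 = 0, dot g n1 = 0, dot g n2 = 0 & dot g n3 = 0].
Proof.
move=> h0 h1 h2 h3 id4.
have eq2 z : refl n1 (refl n0 z) = refl n2 (refl n3 z).
  by rewrite -[LHS](reflK h2) -[refl n2 (refl n1 _)](reflK h3) id4.
have [c01 | c01] := eqVneq (cross n0 n1) 0.
  have c23 : cross n2 n3 = 0.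
    apply: refl_inj => // z.
    rewrite -[RHS](reflK h2) -eq2.
    by rewrite (refl_parallel h0 h1 c01) reflK.
  have par g (m n : 'rV[R]_3) : m != 0 -> cross m n = 0 -> dot g m = 0 -> dot g n = 0.
    by move=> m0 /(cross_eq0 m0) ->; rewrite dotZr => ->; rewrite mulr0.
  have [c02 | c02] := eqVneq (cross n0 n2) 0.
    have [g g0 gn] := perp_exists n0.
    exists g => //; split=> //; first exact: par c01 _.
      exact: par c02 _.
    by apply: (par _ n2) => //; apply: par c02 _.
  exists (cross n0 n2) => //; split; rewrite ?dot_crossl ?dot_crossr //.
    by apply: (par _ n0) => //; apply: dot_crossl.
  by apply: (par _ n2) => //; apply: dot_crossr.
exists (cross n0 n1) => //.
set g := cross n0 n1.
have g0 : dot g n0 = 0 by exact: dot_crossl.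
have g1 : dot g n1 = 0 by exact: dot_crossr.
have e : refl n2 g = refl n3 g.
  by have := eq2 g; rewrite !(refl_fix g0) (refl_fix g1) => {1}->; rewrite reflK.
have [g3 | g3] := eqVneq (dot g n3) 0.
  split => //; move: e; rewrite (refl_fix g3) /refl -[RHS]subr0 => /addrI/oppr_inj/eqP.
  rewrite scaler_eq0 (negbTE h2) orbF.
  by rewrite !mulf_eq0 invr_eq0 (negbTE (dot_neq0 h2)) orbF pnatr_eq0 => /eqP.
case/negP: c01; apply/eqP.
have c23 : cross n2 n3 = 0.
  apply: contraNeq g3 => c23.
  move: e; rewrite /refl => /addrI/oppr_inj e.
  have := congr1 (cross n2) e.
  set k := _ / _; set l := _ / _.
  have -> : cross n2 (k *: n2) = 0 by vec; ring.
  have -> : cross n2 (l *: n3) = l *: cross n2 n3 by vec; ring.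
  move/esym/eqP; rewrite scaler_eq0 (negbTE c23) orbF /l !mulf_eq0 invr_eq0.
  by rewrite (negbTE (dot_neq0 h3)) orbF pnatr_eq0.
apply: refl_inj => // z.
rewrite -[RHS](reflK h1) -[in RHS](reflK h0 z) eq2.
by rewrite (refl_parallel h2 h3 c23) reflK // reflK.
Qed.

End Vectors.

(** * Points on circles and lines *)

Section Circles.
Variable R : realType.
Implicit Types (x y z m n p q d e : 'rV[R]_3) (a : displacement R).

Lemma ord4P (P : 'I_4 -> Prop) : P 0 -> P 1 -> P 2 -> P 3 -> forall i, P i.
Proof.
move=> P0 P1 P2 P3 [[|[|[|[|//]]]] hi].
- by rewrite (_ : Ordinal hi = 0) //; apply: val_inj.
- by rewrite (_ : Ordinal hi = 1) //; apply: val_inj.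
- by rewrite (_ : Ordinal hi = 2) //; apply: val_inj.
- by rewrite (_ : Ordinal hi = 3) //; apply: val_inj.
Qed.

Lemma ord4S : (((0 + 1)%R = 1%R :> 'I_4) * ((1 + 1)%R = 2%R :> 'I_4) *
  ((2 + 1)%R = 3%R :> 'I_4) * ((3 + 1)%R = 0%R :> 'I_4))%type.
Proof. by do !split; apply: val_inj. Qed.

Lemma sum4E (V : zmodType) (F : 'I_4 -> V) : \sum_i F i = F 0 + F 1 + F 2 + F 3.
Proof.
rewrite !big_ord_recl big_ord0 addr0 !addrA.
by congr (_ + F _ + F _ + F _); apply: val_inj.
Qed.

Definition line p d : set 'rV[R]_3 := [set X | exists t : R, X = p + t *: d].

Lemma line_base p d : line p d p.
Proof. by exists 0; rewrite scale0r addr0. Qed.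

Lemma is_line_line p d : d != 0 -> is_line (line p d).
Proof. by move=> d0; exists p, d. Qed.

Lemma is_line_affine (l : set 'rV[R]_3) x y (k : R) :
  is_line l -> l x -> l y -> l (x + k *: (y - x)).
Proof.
case=> p [d [_ ->]] [s ->] [t ->]; exists (s + k * (t - s)).
by vec; ring.
Qed.

Lemma line_through3 x y z : cross (y - x) (z - x) = 0 ->
  exists l, [/\ is_line l, l x, l y & l z].
Proof.
have base := line_base.
have [yx | p0] := eqVneq (y - x) 0.
  have -> : y = x by apply/eqP; rewrite -subr_eq0 yx.
  have [zx _ | q0 _] := eqVneq (z - x) 0.
    have -> : z = x by apply/eqP; rewrite -subr_eq0 zx.
    have [g g0 _] := perp_exists x.
    by exists (line x g); split=> //; apply: is_line_line.
  exists (line x (z - x)); split=> //; first exact: is_line_line.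
  by exists 1; rewrite scale1r addrC subrK.
move/(cross_eq0 p0) => e; exists (line x (y - x)); split=> //.
- exact: is_line_line.
- by exists 1; rewrite scale1r addrC subrK.
- by exists (dot (y - x) (z - x) / dot (y - x) (y - x)); rewrite -e addrC subrK.
Qed.

Lemma circle_through3 x y z : cross (y - x) (z - x) != 0 ->
  exists c n (rho : R), [/\ n != 0, 0 < rho,
    dot (y - x) n = 0, dot (z - x) n = 0 &
    [/\ dot (x - c) n = 0, dot (x - c) (x - c) = rho ^+ 2,
        dot (y - c) (y - c) = rho ^+ 2 & dot (z - c) (z - c) = rho ^+ 2]].
Proof.
set p := y - x; set q := z - x => n0.
have G0 := dot_neq0 n0.
have GE : dot (cross p q) (cross p q) = dot p p * dot q q - dot p q ^+ 2.
  by rewrite !dotE !mxE /=; ring.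
pose G := dot (cross p q) (cross p q).
(* The solution of the linear system saying that the centre, seen from [x],
   projects to the midpoints of [p] and of [q]. *)
pose c := (dot q q * (dot p p - dot p q) / (2 * G)) *: p
          + (dot p p * (dot q q - dot p q) / (2 * G)) *: q.
have cp : 2 * dot c p = dot p p.
  rewrite dotDl !dotZl (dotC q p) /G GE; field.
  by rewrite -GE.
have cq : 2 * dot c q = dot q q.
  rewrite dotDl !dotZl /G GE; field.
  by rewrite -GE.
have /andP[p0 q0] := cross_neq0 n0.
have c0 : c != 0.
  apply: contraNneq (dot_neq0 p0) => h.
  by rewrite -cp h !dotE !mxE !mul0r !addr0 mulr0.
have cn : dot c (cross p q) = 0.
  rewrite dotDl !dotZl (dotC p (cross p q)) (dotC q (cross p q)).
  by rewrite dot_crossl dot_crossr !mulr0 addr0.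
clearbody c.
exists (x + c), (cross p q), (Num.sqrt (dot c c)).
rewrite sqrtr_gt0 dot_gt0 // sqr_sqrtr ?ltW ?dot_gt0 //.
have -> : x - (x + c) = - c by rewrite opprD addrA subrr add0r.
have -> : y - (x + c) = p - c by rewrite opprD addrA.
have -> : z - (x + c) = q - c by rewrite opprD addrA.
split=> //; first by rewrite dotC dot_crossl.
  by rewrite dotC dot_crossr.
clearbody p q.
split.
- by rewrite dotNl cn oppr0.
- by rewrite dotNl dotNr opprK.
- rewrite !(dotDl, dotDr, dotNl, dotNr) (dotC p c) -cp; ring.
- rewrite !(dotDl, dotDr, dotNl, dotNr) (dotC q c) -cq; ring.
Qed.

(** On the paraboloid lift [x] to (x, |x|^2) circles and lines are plane sections,
    so a point whose lift is an affine combination of three other lifts lies on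
    the circle or line through those three points. *)
Lemma concyclic_affine x0 x y z (k l : R) :
  x0 = x + k *: (y - x) + l *: (z - x) ->
  dot x0 x0 = dot x x + k * (dot y y - dot x x) + l * (dot z z - dot x x) ->
  exists C, [/\ is_circle_or_line C, C x0, C x, C y & C z].
Proof.
move=> e0 s0; have [/line_through3 | ] := eqVneq (cross (y - x) (z - x)) 0.
  case=> C [Cl Cx Cy Cz]; exists C; split=> //; first by right.
  have Cw := is_line_affine k Cl Cx Cy.
  rewrite e0 (_ : _ + _ = x + k *: (y - x) +
    1 *: ((x + l *: (z - x) + k *: (y - x)) - (x + k *: (y - x)))); last by vec; ring.
  apply: is_line_affine => //.
  case: Cl Cx Cy Cz {Cw} => p [d [_ ->]] [r ->] [s ->] [t ->].
  by exists (r + l * (t - r) + k * (s - r)); vec; ring.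
move/circle_through3 => [c [n [rho [n0 r0 yn zn [xn xc yc zc]]]]].
exists [set w | dot (w - c) n = 0 /\ dot (w - c) (w - c) = rho ^+ 2].
split=> /=; first by left; exists c, n, rho.
- split.
    have -> : x0 - c = (x - c) + k *: (y - x) + l *: (z - x).
      by rewrite e0; vec; ring.
    by rewrite dotDl dotDl !dotZl xn yn zn !mulr0 !addr0.
  have sq w : dot (w - c) (w - c) = dot w w - 2 * dot w c + dot c c.
    by rewrite !dotE !mxE; ring.
  move: xc yc zc; rewrite !sq s0 => xc yc zc.
  have -> : dot x0 c = dot x c + k * (dot y c - dot x c) + l * (dot z c - dot x c).
    by rewrite e0 !(dotDl, dotZl, dotNl).
  have yx : dot y y - dot x x = 2 * (dot y c - dot x c) by lra.
  have zx : dot z z - dot x x = 2 * (dot z c - dot x c) by lra.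
  rewrite yx zx -xc; ring.
- by split.
- have -> : y - c = (x - c) + (y - x) by vec; ring.
  split; first by rewrite dotDl xn yn addr0.
  by rewrite (_ : _ + _ = y - c) //; vec; ring.
- have -> : z - c = (x - c) + (z - x) by vec; ring.
  split; first by rewrite dotDl xn zn addr0.
  by rewrite (_ : _ + _ = z - c) //; vec; ring.
Qed.

Lemma concyclic_dep (X : 'I_4 -> 'rV[R]_3) (lam : 'I_4 -> R) i :
  lam i != 0 -> \sum_j lam j = 0 -> \sum_j lam j *: X j = 0 ->
  \sum_j lam j * dot (X j) (X j) = 0 ->
  exists C, is_circle_or_line C /\ forall j, C (X j).
Proof.
have key (x0 x y z : 'rV[R]_3) (a b c d : R) : a != 0 -> a + b + c + d = 0 ->
    a *: x0 + b *: x + c *: y + d *: z = 0 ->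
    a * dot x0 x0 + b * dot x x + c * dot y y + d * dot z z = 0 ->
    exists C, [/\ is_circle_or_line C, C x0, C x, C y & C z].
  move=> a0 s; have -> : b = - a - c - d by lra.
  move=> eX eS; apply: (concyclic_affine (k := - c / a) (l := - d / a)).
    apply: (scalerI a0); apply/eqP; rewrite -subr_eq0 -eX.
    by apply/eqP; vec; field.
  apply: (mulfI a0); apply/eqP; rewrite -subr_eq0 -eS.
  by apply/eqP; field.
rewrite !sum4E; move: i; apply: ord4P => l0 s eX eS.
- have [C [? ? ? ? ?]] := key _ _ _ _ _ _ _ _ l0 s eX eS.
  by exists C; split=> //; apply: ord4P.
- have [|||C [? ? ? ? ?]] :=
    key (X 1) (X 0) (X 2) (X 3) _ (lam 0) (lam 2) (lam 3) l0.
  + by rewrite -s; ring.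
  + by rewrite -eX; vec; ring.
  + by rewrite -eS; ring.
  by exists C; split=> //; apply: ord4P.
- have [|||C [? ? ? ? ?]] :=
    key (X 2) (X 0) (X 1) (X 3) _ (lam 0) (lam 1) (lam 3) l0.
  + by rewrite -s; ring.
  + by rewrite -eX; vec; ring.
  + by rewrite -eS; ring.
  by exists C; split=> //; apply: ord4P.
- have [|||C [? ? ? ? ?]] :=
    key (X 3) (X 0) (X 1) (X 2) _ (lam 0) (lam 1) (lam 2) l0.
  + by rewrite -s; ring.
  + by rewrite -eX; vec; ring.
  + by rewrite -eS; ring.
  by exists C; split=> //; apply: ord4P.
Qed.

End Circles.

(** * Four lines with exactly two transversals *)

Section Transversals.
Variable R : realType.
Implicit Types (x y z m n p q d e g : 'rV[R]_3) (l : set 'rV[R]_3).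

Lemma is_line_from l p : is_line l -> l p -> exists2 d, d != 0 & l = line p d.
Proof.
case=> q [d [d0 ->]] [s ->]; exists d => //; apply/seteqP.
split=> x [t ->]; [exists (t - s) | exists (s + t)]; vec; ring.
Qed.

Definition common_transversal (I : Type) (r : I -> set 'rV[R]_3) l :=
  is_line l /\ forall i, l `&` r i !=set0.

Section TwoTransversals.
Variables (I : finType) (r : I -> set 'rV[R]_3) (u v : set 'rV[R]_3).
Hypothesis r_line : forall i, is_line (r i).
Hypothesis uv : u <> v.
Hypothesis only_uv : forall l, common_transversal r l <-> l = u \/ l = v.

Lemma transversal_mem l p : common_transversal r l -> l p -> u p \/ v p.
Proof. by move/only_uv => [->|->]; [left | right]. Qed.

Lemma transversal_u : common_transversal r u.
Proof. by apply/only_uv; left. Qed.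

Lemma transversal_v : common_transversal r v.
Proof. by apply/only_uv; right. Qed.

Lemma transversal_param p d : common_transversal r (line p d) ->
  exists s : I -> R, forall i, r i (p + s i *: d).
Proof.
case=> _ h; suff /choice[s hs] : forall i, exists t, r i (p + t *: d) by exists s.
by move=> i; have [_ [[t ->] rt]] := h i; exists t.
Qed.

(** Every line through a common point of the [r i] would be a transversal. *)
Lemma not_concurrent p : ~ (forall i, r i p).
Proof.
move=> hp; have thru d : d != 0 -> common_transversal r (line p d).
  move=> d0; split; first exact: is_line_line.
  by move=> i; exists p; split=> //; apply: line_base.
have nz d w : w != 0 -> dot w d = 0 -> forall k : R, w <> k *: d.
  move=> w0 wd k e; move: (dot_neq0 w0).
  by rewrite {2}e dotZr wd mulr0 eqxx.
have two d w : d != 0 -> w != 0 -> dot w d = 0 -> line p d <> line p w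
    /\ line p (w + d) <> line p w /\ line p (w + d) <> line p d.
  move=> d0 w0 wd; split; [|split] => h.
  - have : line p w (p + d) by rewrite -h; exists 1; rewrite scale1r.
    by case=> k /addrI; apply: nz; rewrite // dotC.
  - have : line p w (p + (w + d)) by rewrite -h; exists 1; rewrite scale1r.
    case=> k /addrI e; apply: (@nz w d d0 _ (k - 1)); first by rewrite dotC.
    by rewrite scalerBl scale1r -e addrAC subrr add0r.
  - have : line p d (p + (w + d)) by rewrite -h; exists 1; rewrite scale1r.
    case=> k /addrI e; apply: (@nz d w w0 wd (k - 1)).
    by rewrite scalerBl scale1r -e addrK.
(* Three pairwise different directions are too many for two lines. *)
have [d d0 _] := perp_exists (0 : 'rV[R]_3).
have [w w0 wd] := perp_exists d.
have wd0 : w + d != 0.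
  apply/eqP => h; apply: (@nz d w w0 wd (-1)).
  by rewrite scaleN1r; apply/eqP; rewrite -addr_eq0 h.
have [n1 [n2 n3]] := two d w d0 w0 wd.
have [h1 h2 h3] : [/\ _, _ & _] := And3 (proj1 (only_uv _) (thru _ d0))
  (proj1 (only_uv _) (thru _ w0)) (proj1 (only_uv _) (thru _ wd0)).
by case: h1 h2 h3 => h1 [h2|h2] [h3|h3]; congruence.
Qed.

(** The line midway between parallel transversals is a transversal. *)
Lemma not_parallel p q d (k : R) :
  d != 0 -> k != 0 -> u = line p d -> v = line q (k *: d) -> False.
Proof.
move=> d0 k0 eu ev; have hu := transversal_u; have hv := transversal_v.
have uq : ~ u q.
  rewrite eu => -[a qa]; apply: uv; rewrite eu ev qa; apply/seteqP.
  split=> x [t ->]; [exists ((t - a) / k) | exists (a + t * k)]; last by vec; ring.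
  by vec; field.
have := hu; rewrite eu => /transversal_param[s hs].
have := hv; rewrite ev => /transversal_param[t ht].
pose m := p + 2^-1 *: (q - p).
have tm : common_transversal r (line m d).
  split; first exact: is_line_line.
  move=> i; exists (m + (2^-1 * (s i + k * t i)) *: d); split; first by eexists.
  have := is_line_affine 2^-1 (r_line i) (hs i) (ht i).
  by congr (r i _); rewrite /m; vec; field.
apply: uq; have [] := transversal_mem tm (line_base m d); rewrite ?eu ?ev.
  case=> a; rewrite /m => /addrI e; exists (2 * a).
  by rewrite -scalerA -e scalerA divff ?pnatr_eq0 // scale1r addrC subrK.
case=> a; rewrite /m => e; exists (- (2 * a * k)).
transitivity (p + 2 *: (q - (p + 2^-1 *: (q - p)))); first by vec; field.
by rewrite e; vec; ring.
Qed.

(** If the two transversals meet in [p], each [r i] passes through [p] or lies in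
    their plane, so almost every line of this plane through [p] is a
    transversal. *)
Lemma not_meeting p d e : cross d e != 0 -> u = line p d -> v = line p e -> False.
Proof.
move=> de eu ev; have /andP[d0 e0] := cross_neq0 de.
have := transversal_u; rewrite eu => /transversal_param[s hs].
have := transversal_v; rewrite ev => /transversal_param[t ht].
(* The direction [d + k *: e] is parallel to [r i] if [k = - (t i / s i)]; the
   choice exceeds all these values.  Where [s i = 0], the line [r i] passes
   through [p] and the quotient, being 0, has no effect on the sum. *)
pose k := 1 + \sum_i `|t i / s i|.
have k_gt0 : 0 < k by rewrite ltr_pwDl // sumr_ge0.
have kP i : t i + k * s i != 0 \/ s i = 0.
  have [->|si0] := eqVneq (s i) 0; [by right | left].
  apply/eqP => h; have kE : k = - (t i / s i).
    apply: (mulIf si0); rewrite mulNr divfK //; lra.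
  suff : `|t i / s i| < k by rewrite kE ltNge ler_normr lexx orbT.
  rewrite /k (bigD1 i) //= addrCA ltr_pwDr // ltr_pwDl // sumr_ge0 //.
have w0 : d + k *: e != 0.
  apply: contraNneq de => h; apply/eqP.
  have -> : cross d e = cross (d + k *: e) e by vec; ring.
  by rewrite h; vec; ring.
have tm : common_transversal r (line p (d + k *: e)).
  split; first exact: is_line_line.
  move=> i; have [hk|s0] := kP i; last first.
    by exists p; split; [exact: line_base | have := hs i; rewrite s0 scale0r addr0].
  exists (p + (t i * s i / (t i + k * s i)) *: (d + k *: e)); split; first by eexists.
  have := is_line_affine (k * s i / (t i + k * s i)) (r_line i) (hs i) (ht i).
  by congr (r i _); vec; field.
have dot0 : dot (k *: e) (cross d e) = 0 by rewrite dotC dotZr dot_crossr mulr0.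
have : line p (d + k *: e) (p + (d + k *: e)) by exists 1; rewrite scale1r.
case/(transversal_mem tm); rewrite ?eu ?ev => -[a /addrI h].
  have : k *: cross d e = 0.
    have -> : k *: cross d e = cross d (d + k *: e) by vec; ring.
    by rewrite h; vec; ring.
  by move/eqP; rewrite scaler_eq0 (negbTE de) orbF gt_eqF.
case/eqP: de; have -> : cross d e = cross (d + k *: e) e by vec; ring.
by rewrite h; vec; ring.
Qed.

Lemma not_coplanar p d q e : d != 0 -> e != 0 -> u = line p d -> v = line q e ->
  dot (cross d e) (q - p) != 0.
Proof.
move=> d0 e0 eu ev; apply/eqP => h.
have [c0 | de] := eqVneq (cross d e) 0.
  move: ev e0; rewrite (cross_eq0 d0 c0); set k := _ / _ => ev.
  rewrite scaler_eq0 negb_or => /andP[k0 _].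
  exact: not_parallel d0 k0 eu ev.
have := cramer3 d e (cross d e) (q - p).
rewrite [dot (q - p) (cross d e)]dotC h scale0r addr0.
set a := dot _ (cross e _); set b := dot _ (cross _ d); set D := dot _ _ => E.
have D0 : D != 0 by exact: dot_neq0.
have qE : p + (a / D) *: d = q + (- (b / D)) *: e.
  rewrite scaleNr; apply/eqP; rewrite eq_sym subr_eq -addrA -subr_eq0.
  have -> : q - (p + ((a / D) *: d + (b / D) *: e)) =
      (q - p) - D^-1 *: (a *: d + b *: e).
    clearbody a b D; vec; ring.
  by rewrite -E scalerA mulVf // scale1r subrr.
have lu : u (p + (a / D) *: d) by rewrite eu; exists (a / D).
have lv : v (p + (a / D) *: d) by rewrite ev qE; exists (- (b / D)).
have shift x y w : line x w y -> line x w = line y w.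
  case=> c ->; apply/seteqP.
  by split=> z [f ->]; [exists (f - c) | exists (c + f)]; vec; ring.
apply: (@not_meeting (p + (a / D) *: d) d e de).
  by rewrite eu; apply: shift; rewrite -eu.
by rewrite ev; apply: shift; rewrite -ev.
Qed.

(** A line through [x] with direction [g] that is coplanar with every [r i] cannot
    be parallel to one of them.  Since the two transversals are skew, they
    provide affine coordinates in which the first is y = z = 0, the second is
    x = 0, z = 1, the line [r k] is the z-axis, and [r i] joins (s_i, 0, 0) to
    (0, t_i, 1).  The given line is then vertical, over some point (a, b), and
    coplanarity means s_i t_i = a t_i + b s_i.  Under this relation each line
    y = j + (b - j) z, x = (a / j) y with j != 0 meets [r i] where
    z = j / (t_i + j - b).  Such a line is neither of the two transversals, so it
    suffices to choose [j] with nonzero denominators. *)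
Lemma axis_not_parallel x g k :
  (forall i, exists2 n, n != 0 &
     dot g n = 0 /\ forall y, r i y -> dot (y - x) n = 0) ->
  (forall y z, r k y -> r k z -> exists a : R, z - y = a *: g) ->
  False.
Proof.
move=> hn hk.
have [p [up rp]] := (transversal_u).2 k.
have [q [vq rq]] := (transversal_v).2 k.
have [d d0 eu] := is_line_from (transversal_u).1 up.
have [e e0 ev] := is_line_from (transversal_v).1 vq.
have := transversal_u; rewrite {1}eu => /transversal_param[s hs].
have := transversal_v; rewrite {1}ev => /transversal_param[t ht].
have det0 := not_coplanar d0 e0 eu ev.
have [c fE] := hk _ _ rp rq.
set f := q - p in det0 fE.
have qE : q = p + f by rewrite addrC subrK.
pose D := dot (cross d e) f.
pose a := dot (x - p) (cross e f) / D.
pose b := dot (x - p) (cross f d) / D.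
pose z := dot (x - p) (cross d e) / D.
have xE : x = p + a *: d + b *: e + z *: f.
  have -> : x = p + D^-1 *: (D *: (x - p)).
    by rewrite scalerA mulVf // scale1r addrC subrK.
  rewrite /D cramer3 -/D /a /b /z; clearbody D f; vec; ring.
(* The normal [n] of the plane through the given line and [r i] satisfies two
   linear equations in its components along [d] and [e]; their determinant
   vanishes. *)
have eqn i : s i * t i = a * t i + b * s i.
  have [n n0 [gn rn]] := hn i.
  have fn : dot f n = 0 by rewrite fE dotZl gn mulr0.
  have := rn _ (hs i); have := rn _ (ht i).
  have -> : q + t i *: e - x = (t i - b) *: e + (- a) *: d + (1 - z) *: f.
    by rewrite {1}xE qE; clearbody a b z f; vec; ring.
  have -> : p + s i *: d - x = (- b) *: e + (s i - a) *: d + (- z) *: f.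
    by rewrite {1}xE; clearbody a b z f; vec; ring.
  rewrite !dotDl !dotZl fn !mulr0 !addr0 => h1 h2.
  have [dn0|dn0] := eqVneq (dot d n) 0.
    have en0 : dot e n != 0.
      apply: contraNneq n0 => en0; have := cramer3 d e f n.
      move/(congr1 (fun w : 'rV[R]_3 => dot w n)).
      rewrite !dotDl !dotZl fn dn0 en0 !mulr0 !addr0.
      move/eqP; rewrite mulf_eq0 (negbTE det0) /=.
      by apply: contraLR => /dot_neq0.
    move: h1 h2; rewrite dn0 !mulr0 !addr0 => /eqP + /eqP.
    rewrite !mulf_eq0 (negbTE en0) !orbF subr_eq0 oppr_eq0 => /eqP-> /eqP->.
    ring.
  apply: (mulIf dn0).
  have -> : s i * t i * dot d n = t i * (s i * dot d n) by ring.
  have sE : s i * dot d n = a * dot d n + b * dot e n by lra.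
  have tE : t i * dot e n = b * dot e n + a * dot d n by lra.
  transitivity (a * t i * dot d n + b * (t i * dot e n)); first by rewrite sE; ring.
  rewrite tE mulrDl -[b * s i * _]mulrA sE; ring.
(* Large enough for all the denominators to be positive. *)
pose j := 1 + `|b| + \sum_i `|t i|.
have sum0 : 0 <= \sum_i `|t i| by rewrite sumr_ge0.
have j_gt0 : 0 < j by rewrite /j; have := normr_ge0 b; lra.
have jP i : t i + j - b != 0.
  have : `|t i| <= \sum_i `|t i| by rewrite (bigD1 i) //= lerDl sumr_ge0.
  move=> ti; apply: lt0r_neq0; rewrite /j.
  have := ler_norm b; have := ler_norm (- t i); rewrite normrN; lra.
have j0 : j != 0 by rewrite gt_eqF.
pose w := (a / j * (b - j)) *: d + (b - j) *: e + f.
have w0 : w != 0.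
  apply: contraNneq det0 => w0; rewrite dotC.
  have -> : dot f (cross d e) = dot w (cross d e).
    by rewrite !dotDl !dotZl !(dotC _ (cross d e)) dot_crossl dot_crossr !mulr0 !add0r.
  by rewrite w0 !dotE !mxE /=; apply/eqP; ring.
pose m := p + a *: d + j *: e.
have tm : common_transversal r (line m w).
  split; first exact: is_line_line.
  move=> i; exists (m + (j / (t i + j - b)) *: w); split; first by eexists.
  have := is_line_affine (j / (t i + j - b)) (r_line i) (hs i) (ht i).
  congr (r i _); rewrite /m /w.
  have -> : p + s i *: d + (j / (t i + j - b)) *: (q + t i *: e - (p + s i *: d)) =
     p + ((s i * t i - b * s i) / (t i + j - b)) *: d
       + (j / (t i + j - b) * t i) *: e + (j / (t i + j - b)) *: f.
    by rewrite qE; clearbody a b z f j; vec; field; exact: jP.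
  by rewrite eqn addrK; clearbody a b z f j; vec; field; rewrite j0 jP.
have [] := transversal_mem tm (line_base m w); rewrite ?eu ?ev => -[h hE].
  have : dot (m - p) (cross f d) = 0.
    rewrite hE addrC addKr dotZl dotC dot_crossr mulr0 //.
  have -> : m - p = a *: d + j *: e by rewrite /m -(addrA p) addrC addrK.
  rewrite dotDl !dotZl dotC dot_crossr mulr0 add0r.
  move/eqP; rewrite mulf_eq0 (negbTE j0) /=; apply/negP.
  by rewrite (_ : dot e _ = dot (cross d e) f) // !dotE !mxE /=; ring.
case/eqP: det0.
have -> : f = a *: d + (j - h) *: e.
  transitivity (m - h *: e - p); first by rewrite hE addrK.
  by rewrite /m; clearbody a b z f j; vec; ring.
by rewrite dotDr !dotZr dot_crossl dot_crossr !mulr0 addr0.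
Qed.

End TwoTransversals.

End Transversals.

(** * Displacements *)

Section Kinematics.
Variable R : realType.
Implicit Types (x y z m n p q d e g : 'rV[R]_3) (l : set 'rV[R]_3).
Implicit Types (a b : displacement R).

Lemma displacementB a x y : a x - a y = (x - y) *m dlin a.
Proof. by rewrite /dapp opprD addrACA subrr addr0 mulmxBl. Qed.

Lemma displacement_line a p d (t : R) : a (p + t *: d) = a p + t *: (d *m dlin a).
Proof. by rewrite /dapp mulmxDl -scalemxAl addrAC. Qed.

(** The points where [a] and [b] agree contain the preimage of the axis of the
    rotation.  One more such point would make the rotation the identity, since
    its linear part would fix two independent vectors. *)
Lemma coincidence_line a b : pure_rotation (dcomp b (dinv a)) ->
  is_line [set x | a x = b x].
Proof.
case=> l [[P [D [D0 ->]]] fixl [Y mvY]].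
pose p := dinv a P; pose d := D *m (dlin a)^T.
have da : d *m dlin a = D by rewrite -mulmxA (mulmx1C (dlin_orth a)) mulmx1.
have onl t : a (p + t *: d) = P + t *: D by rewrite displacement_line da dinvKV.
have abl t : a (p + t *: d) = b (p + t *: d).
  by rewrite onl -[LHS]fixl; [rewrite dcompE -onl dinvK | exists t].
have d0 : d != 0 by apply: contraNneq D0 => h; rewrite -da h mul0mx.
exists p, d; split=> //; apply/seteqP; split=> x /=; last by case=> t ->.
move=> abx; apply: contrapT => nx.
have dab : d *m dlin a = d *m dlin b.
  have := abl 1; have := abl 0; rewrite scale0r addr0 scale1r => h0 h1.
  by rewrite -[d](addKr p) addrC -!displacementB h0 h1.
have qab : (x - p) *m dlin a = (x - p) *m dlin b.
  have := abl 0; rewrite scale0r addr0 => h0.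
  by rewrite -!displacementB h0 abx.
have n0 : cross d (x - p) != 0.
  apply/eqP => c0; apply: nx; exists (dot d (x - p) / dot d d).
  by rewrite -(cross_eq0 d0 c0) addrC subrK.
have eqab z : z *m dlin a = z *m dlin b.
  apply: (linear_eq3 (f := mulmxr (dlin a)) (g := mulmxr (dlin b)) n0) => //=.
  by rewrite -!cross_rot dab qab.
case/eqP: mvY; rewrite dcompE.
have tab : dtrans a = dtrans b.
  by move: abx; rewrite /dapp eqab => /addrI.
have -> : b (dinv a Y) = a (dinv a Y) by rewrite /dapp eqab tab.
exact: dinvKV.
Qed.

Lemma line_meets_or_parallel x p d g :
  cross d (x - p) != 0 -> g != 0 -> dot g (cross d (x - p)) = 0 ->
  (line x g `&` line p d !=set0) \/ exists c : R, d = c *: g.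
Proof.
set q := x - p; set n := cross d q => n0 g0 gn.
have := cramer3 d q n g; rewrite -/n gn scale0r addr0.
set nn := dot n n; set al := dot _ _; set be := dot _ _ => E.
have nn0 : nn != 0 by exact: dot_neq0.
have [be0 | be0] := eqVneq be 0; [right | left].
  have al0 : al != 0.
    apply: contraNneq g0 => al0; move/eqP: E.
    by rewrite be0 al0 !scale0r addr0 scaler_eq0 (negbTE nn0).
  exists (nn / al); rewrite mulrC -scalerA E be0 scale0r addr0 scalerA mulVf //.
  by rewrite scale1r.
exists (x - (nn / be) *: g); split; first by exists (- (nn / be)); rewrite scaleNr.
exists (- (al / be)).
rewrite mulrC -scalerA E scalerDr !scalerA mulVf // scale1r /q.
by clearbody al be; vec; ring.
Qed.

(** Linear parts of the identity sigma a = b rho, where sigma is the reflection in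
    the perpendicular bisector of [a x] and [b x], and rho the one in the plane
    spanned by [x] and the line where [a] and [b] agree.  Both sides map that
    plane in the same way, and the cross product settles the normal direction. *)
Lemma bisector_pullback a b x p d : d != 0 ->
  [set y | a y = b y] = line p d -> a x <> b x ->
  let n := cross d (x - p) in
  n != 0 /\ forall z, refl (b x - a x) (z *m dlin a) = refl n z *m dlin b.
Proof.
move=> d0 axis abx n.
have ab y : line p d y -> a y = b y by rewrite -axis.
have abp := ab _ (line_base p d).
have dab : d *m dlin a = d *m dlin b.
  have : a (p + 1 *: d) = b (p + 1 *: d) by apply: ab; exists 1.
  by rewrite !displacement_line abp !scale1r => /addrI.
have n0 : n != 0.
  apply/eqP => c0; apply: abx; apply: ab; exists (dot d (x - p) / dot d d).
  by rewrite -(cross_eq0 d0 c0) addrC subrK.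
have m0 : b x - a x != 0 by rewrite subr_eq0 eq_sym; apply/eqP.
set q := x - p in n n0 *.
have mE : b x - a x = q *m dlin b - q *m dlin a.
  by rewrite -!displacementB abp opprB addrA subrK.
have qab : q *m dlin a != q *m dlin b.
  by apply: contraNneq m0 => h; rewrite mE h subrr.
have Rd : refl (b x - a x) (d *m dlin a) = d *m dlin b.
  rewrite refl_fix // mE dotDr dotNr {1}dab !dot_rot subrr //.
have Rq : refl (b x - a x) (q *m dlin a) = q *m dlin b.
  by rewrite mE; apply: refl_swap; rewrite ?dot_rot.
split=> // z.
apply: (linear_eq3 (f := refl (b x - a x) \o mulmxr (dlin a))
                   (g := mulmxr (dlin b) \o refl n) n0) => /=.
- by rewrite Rd refl_fix // dotC dot_crossl.
- by rewrite Rq refl_fix // dotC dot_crossr.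
- rewrite -/n refl_normal // mulNmx /n -!cross_rot.
  by rewrite -[refl _ _]opprK -cross_refl // Rd Rq.
Qed.

(** Around a closed quadrilateral inscribed in a circle, the reflections in the
    bisectors of the sides carry the radius to the first vertex through the
    other radii back to itself, and they fix the normal of the plane of the
    circle.  Being an even number, they compose to a rotation, which is the
    identity.  On a line all four reflections have the same linear part. *)
Lemma refl_chords x0 x1 x2 x3 C : is_circle_or_line C ->
  C x0 -> C x1 -> C x2 -> C x3 ->
  x0 != x1 -> x1 != x2 -> x2 != x3 -> x3 != x0 ->
  forall z, refl (x0 - x3) (refl (x3 - x2) (refl (x2 - x1) (refl (x1 - x0) z))) = z.
Proof.
case=> [[c [n [rho [n0 r0 ->]]]] | [p [d [d0 ->]]]]; last first.
  move=> [t0 ->] [t1 ->] [t2 ->] [t3 ->].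
  have key s t : p + s *: d != p + t *: d -> refl (p + t *: d - (p + s *: d)) =1 refl d.
    move=> st; rewrite (_ : _ - _ = (t - s) *: d); last by vec; ring.
    by apply: reflZ; apply: contraNneq st => /eqP; rewrite subr_eq0 => /eqP->.
  by move=> /key h1 /key h2 /key h3 /key h4 z; rewrite h1 h2 h3 h4 !(reflK d0).
move=> [xn0 xc0] [xn1 xc1] [xn2 xc2] [xn3 xc3] h1 h2 h3 h4.
have chord x y : dot (x - c) n = 0 -> dot (y - c) n = 0 ->
    dot (x - c) (x - c) = rho ^+ 2 -> dot (y - c) (y - c) = rho ^+ 2 -> x != y ->
  [/\ y - x != 0, refl (y - x) n = n & refl (y - x) (x - c) = y - c].
  move=> xn yn xc yc xy.
  have e : y - x = (y - c) - (x - c) by rewrite opprB addrA subrK.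
  split; first by rewrite subr_eq0 eq_sym.
    by rewrite refl_fix // dotC e dotDl dotNl xn yn subrr.
  rewrite e; apply: refl_swap; first by rewrite xc yc.
  by apply: contraNneq xy => /addIr->.
have [m1 n1 c1] := chord _ _ xn0 xn1 xc0 xc1 h1.
have [m2 n2 c2] := chord _ _ xn1 xn2 xc1 xc2 h2.
have [m3 n3 c3] := chord _ _ xn2 xn3 xc2 xc3 h3.
have [m4 n4 c4] := chord _ _ xn3 xn0 xc3 xc0 h4.
have x0c : x0 - c != 0.
  apply/eqP => h; move: xc0; rewrite h dotE !mxE => /eqP.
  by rewrite !mul0r !addr0 eq_sym sqrf_eq0 gt_eqF.
have nx : cross n (x0 - c) != 0.
  apply/eqP => /(cross_eq0 n0); rewrite dotC xn0 mul0r scale0r => h.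
  by rewrite h eqxx in x0c.
move=> z; apply: (linear_eq3 (f := refl (x0 - x3) \o (refl (x3 - x2) \o
  (refl (x2 - x1) \o refl (x1 - x0)))) (g := idfun) nx) => /=.
- by rewrite n1 n2 n3 n4.
- by rewrite c1 c2 c3 c4.
- have cr m x y : m != 0 -> refl m (cross x y) = - cross (refl m x) (refl m y).
    by move/cross_refl->; rewrite opprK.
  rewrite (cr _ _ _ m1) !linearN /= (cr _ _ _ m2) !linearN /= opprK.
  rewrite (cr _ _ _ m3) linearN /= (cr _ _ _ m4) opprK.
  by rewrite n1 n2 n3 n4 c1 c2 c3 c4.
Qed.

(** The points of contact of a skew quadrilateral with equal tangent segments at
    each vertex.  Here [E j] directs the side that carries [X j], and the vertex
    between two consecutive sides is X_j - t_j E_j = X_{j+1} - t_j E_{j+1}.  The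
    differences of consecutive lifts (X_j, |X_j|^2), divided by [t j], are the
    differences of (E_j, 2 E_j . X_j), so they add up to zero around the cycle.
    This is a linear dependency between the four lifts, and it is trivial only
    if all [t j] are equal. *)
Lemma tangential_concyclic (X E : 'I_4 -> 'rV[R]_3) (t : 'I_4 -> R) (k : R) i :
  (forall j, t j != 0) -> (forall j, dot (E j) (E j) = k) ->
  (forall j, X (j + 1) - X j = t j *: (E (j + 1) - E j)) ->
  t i != t (i + 1) ->
  exists C, is_circle_or_line C /\ forall j, C (X j).
Proof.
move=> t0 Ek XE ti.
pose mu j := (t j)^-1.
pose lam (j : 'I_4) := mu (j + 3) - mu j.
have s3 : (((0 + 3)%R = 3%R :> 'I_4) * ((1 + 3)%R = 0%R :> 'I_4) *
  ((2 + 3)%R = 1%R :> 'I_4) * ((3 + 3)%R = 2%R :> 'I_4))%type.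
  by do !split; apply: val_inj.
have muX j : mu j *: (X (j + 1) - X j) = E (j + 1) - E j.
  by rewrite XE scalerA mulVf ?scale1r.
have muS j : mu j * (dot (X (j + 1)) (X (j + 1)) - dot (X j) (X j)) =
    2 * (dot (E (j + 1)) (X (j + 1)) - dot (E j) (X j)).
  have e : X (j + 1) = X j + t j *: (E (j + 1) - E j) by rewrite -XE [RHS]addrC subrK.
  apply: (mulfI (t0 j)); rewrite mulrA divff // mul1r e.
  have h0 := Ek j; have h1 := Ek (j + 1).
  rewrite !(dotDl, dotDr, dotZl, dotZr, dotNl, dotNr) h0 h1.
  rewrite (dotC (E j) (E (j + 1))) (dotC (X j) (E j)) (dotC (X j) (E (j + 1))).
  ring.
apply: (@concyclic_dep _ X lam (i + 1)).
- by rewrite /lam -addrA s3 addr0 subr_eq0 (inj_eq invr_inj).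
- by rewrite sum4E /lam !s3; ring.
- rewrite sum4E /lam !s3.
  transitivity (\sum_j mu j *: (X (j + 1) - X j)).
    by rewrite sum4E !ord4S; vec; ring.
  by rewrite (eq_bigr _ (fun j _ => muX j)) sum4E !ord4S; vec; ring.
- rewrite sum4E /lam !s3.
  transitivity (\sum_j mu j * (dot (X (j + 1)) (X (j + 1)) - dot (X j) (X j))).
    by rewrite sum4E !ord4S; ring.
  by rewrite (eq_bigr _ (fun j _ => muS j)) sum4E !ord4S; ring.
Qed.

End Kinematics.

(** * The locus *)

Section Locus.
Variables (R : realType) (alpha : 'I_4 -> displacement R).
Implicit Types (x : 'rV[R]_3) (l : set 'rV[R]_3).

Lemma revolute_axis_sub_locus i : revolute_axis alpha i `<=` circle_locus alpha.
Proof.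
move=> x; rewrite /revolute_axis /= => e.
have [||C [Cl C0 C1 C2 C3]] := @concyclic_affine R (alpha i x) (alpha (i + 1) x)
  (alpha (i + 1 + 1) x) (alpha (i + 1 + 1 + 1) x) 0 0.
- by rewrite e !scale0r !addr0.
- by rewrite e !mul0r !addr0.
exists C; split=> //; move: i e C0 C1 C2 C3.
by apply: ord4P => _; rewrite !ord4S => ? ? ? ?; apply: ord4P.
Qed.

Lemma transversal_sub_locus l : axes_transversal alpha l ->
  ~ (exists p, forall i, revolute_axis alpha i p) -> l `<=` circle_locus alpha.
Proof.
move=> tl nc x lx.
have [p [d [d0 le]]] := tl.1.
move: tl lx; rewrite le => /transversal_param[s hs] [c xE].
have [[i ti]|t0] := EM (exists i, c - s i = 0).
  apply: (@revolute_axis_sub_locus i).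
  by have := hs i; rewrite -(subr0_eq ti) -xE.
have [i ti] : exists i, c - s i != c - s (i + 1).
  apply: contrapT => h; apply: nc; exists (p + s 0 *: d).
  have st i : s i = s (i + 1).
    apply: contrapT => si; apply: h; exists i; apply/eqP => e; apply: si.
    by apply: oppr_inj; apply: (addrI c).
  have := st 0; have := st 1; have := st 2; rewrite !ord4S => s2 s1 s0.
  apply: ord4P; first exact: hs.
  - by rewrite s0; apply: hs.
  - by rewrite s0 s1; apply: hs.
  - by rewrite s0 s1 s2; apply: hs.
apply: (@tangential_concyclic R (fun j => alpha j x) (fun j => d *m dlin (alpha j))
  (fun j => c - s j) (dot d d) i) => //.
- by move=> j; apply/eqP => h; apply: t0; exists j.
- by move=> j; rewrite dot_rot.
move=> j; have := hs j; rewrite /revolute_axis /= => sj.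
have -> : x = (p + s j *: d) + (c - s j) *: d by rewrite xE; vec; ring.
by rewrite !(displacement_line _ (p + s j *: d)) sj opprD addrACA subrr add0r scalerBr.
Qed.

Lemma locus_off_axes (u v : set 'rV[R]_3) x : rotation_quadrangle alpha -> u <> v ->
  (forall l, axes_transversal alpha l <-> l = u \/ l = v) ->
  circle_locus alpha x -> (forall i, ~ revolute_axis alpha i x) -> u x \/ v x.
Proof.
move=> hrot uv only [C [Cl Cx]] nax.
have axis_line i : is_line (revolute_axis alpha i).
  exact: coincidence_line (hrot i).
have [p hp] := choice axis_line; have [d hd] := choice hp.
have {}hp i : revolute_axis alpha i = line (p i) (d i) := (hd i).2.
have {}hd i := (hd i).1.
pose n i := cross (d i) (x - p i).
pose m i := alpha (i + 1) x - alpha i x.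
have n0m i : n i != 0 /\
    forall z, refl (m i) (z *m dlin (alpha i)) = refl (n i) z *m dlin (alpha (i + 1)).
  exact: (@bisector_pullback R _ _ x (p i) (d i) (hd i) (hp i) (nax i)).
have n0 i := (n0m i).1; have nm i := (n0m i).2.
have ne i : alpha i x != alpha (i + 1) x by apply/eqP; apply: nax.
have id4 z : refl (n 3) (refl (n 2) (refl (n 1) (refl (n 0) z))) = z.
  have := refl_chords Cl (Cx 0) (Cx 1) (Cx 2) (Cx 3).
  have := ne 0; have := ne 1; have := ne 2; have := ne 3; rewrite !ord4S => e3 e2 e1 e0.
  move=> /(_ e0 e1 e2 e3 (z *m dlin (alpha 0))).
  have := nm 0; have := nm 1; have := nm 2; have := nm 3; rewrite /m !ord4S.
  move=> h3 h2 h1 h0; rewrite h0 h1 h2 h3 => /(congr1 (mulmx^~ (dlin (alpha 0))^T)).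
  by rewrite -!mulmxA dlin_orth !mulmx1.
have [g g0 [g_0 g_1 g_2 g_3]] := common_perp (n0 0) (n0 1) (n0 2) (n0 3) id4.
have gn i : dot g (n i) = 0 by move: i; apply: ord4P.
have [all_meet|] := EM (forall i, line x g `&` revolute_axis alpha i !=set0).
  apply: (transversal_mem only _ (line_base x g)).
  by split; [exact: is_line_line | exact: all_meet].
move=> /existsNP[k nk]; exfalso.
have [|[c dk]] := line_meets_or_parallel (n0 k) g0 (gn k).
  by rewrite -hp => /nk.
apply: (@axis_not_parallel R _ (revolute_axis alpha) u v axis_line uv only x g k).
  move=> i; exists (n i) => //; split=> // y; rewrite hp => -[t ->].
  have -> : p i + t *: d i - x = t *: d i - (x - p i) by vec; ring.
  by rewrite dotC dotDr dotZr dotNr dot_crossl dot_crossr mulr0 subrr.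
move=> y z; rewrite hp => -[s ->] [t ->]; exists ((t - s) * c).
by rewrite dk; vec; ring.
Qed.

End Locus.

Theorem theorem2 (R : realType) (alpha : 'I_4 -> displacement R)
    (A : 'I_4 -> 'rV[R]_(4 + 4)) (u v : set 'rV[R]_3)
    (hrot : rotation_quadrangle alpha)
    (hA : forall i : 'I_4, study_image (alpha i) (A i))
    (hspan : \rank (\matrix_(i < 4) A i) = 4%N)
    (hnotS : ~ (forall w : 'rV[R]_(4 + 4),
                  (w <= \matrix_(i < 4) A i)%MS -> study_quadric w))
    (huv : u <> v)
    (htrans : forall l : set 'rV[R]_3, axes_transversal alpha l <-> l = u \/ l = v) :
  circle_locus alpha =
    revolute_axis alpha 0 `|` revolute_axis alpha 1 `|`
    revolute_axis alpha 2 `|` revolute_axis alpha 3 `|` u `|` v.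
Proof.
have nc : ~ (exists p, forall i, revolute_axis alpha i p).
  by move=> [p]; apply: not_concurrent htrans p.
have [tu tv] : axes_transversal alpha u /\ axes_transversal alpha v.
  by split; apply/htrans; [left | right].
apply/seteqP; split=> x.
  move=> Cx; have [[i xi]|nax] := EM (exists i, revolute_axis alpha i x).
    by move: i xi; apply: ord4P => xi; do ?[exact: xi | by right | left].
  have nax' i : ~ revolute_axis alpha i x by move=> xi; apply: nax; exists i.
  by have [] := locus_off_axes hrot huv htrans Cx nax'; [left; right | right].
case=> [[[[[|]|]|]|]|]; try exact: revolute_axis_sub_locus.
  exact: transversal_sub_locus.
exact: transversal_sub_locus.
Qed.
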